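(* Let $c>0$ and $\alpha\in(0,1)$, and consider $\pi_1$ under the measure $\mathcal{P}_n^{(1-\frac{c}{n^\alpha})}$ (for $n$ large enough that $1-\frac{c}{n^\alpha}>0$). Then, as $n\to\infty$, $\frac{\pi_1}{n^\alpha}$ converges in distribution to the distribution on $[0,\infty)$ with density $ce^{-cx}$, that is, to the exponential distribution with parameter $c$.
   Context: Write $[n]=\{1,\ldots,n\}$ and let $S_n$ be the set of permutations of $[n]$, written in one-line notation $\sigma=\sigma_1\cdots\sigma_n$; $\sigma^{-1}_k$ is the position of $k$ in $\sigma$. A parking function of length $n$ is a sequence $\pi=(\pi_1,\ldots,\pi_n)\in[n]^n$ with $|\{i:\pi_i\le j\}|\ge j$ for all $j\in[n]$; $PF_n$ is the set of these. The inversion statistic is $I_n(\sigma)=\sum_{1\le i<j\le n}1_{\sigma_j<\sigma_i}$. For $j\in[n]$ let $I_{n,<j}(\sigma)=\sum_{1\le i<j}1_{\sigma^{-1}_j<\sigma^{-1}_i}$ (the number of inversions of $\sigma$ involving $j$ and a number less than $j$) and $\tilde I_{n,<j}=I_{n,<j}+1$. For $q\in(0,\infty)$, the Mallows measure on $S_n$ is $P_n^{(q)}(\sigma)=q^{I_n(\sigma)}/K_n$, where $K_n=\sum_{\rho\in S_n}q^{I_n(\rho)}$ is the normalizing constant; $P_n$ denotes the uniform measure on $S_n$. The map $(\sigma,\tau)\mapsto(\tilde I_{n,<\tau_1}(\sigma),\ldots,\tilde I_{n,<\tau_n}(\sigma))$ sends $S_n\times S_n$ into $PF_n$, and $\mathcal{P}_n^{(q)}$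 denotes the probability measure on $PF_n$ that is the image of $P_n^{(q)}\times P_n$ under this map. $\pi_1$ denotes the first coordinate of the random parking function $\pi=(\pi_1,\ldots,\pi_n)\in PF_n$ (the dependence on $n$ is suppressed). *)

(* Defs.v *)
From HB Require Import structures.
From mathcomp Require Import all_boot all_order all_algebra all_fingroup.
From mathcomp Require Import all_classical all_reals all_analysis.
Set Implicit Arguments.
Unset Strict Implicit.
Unset Printing Implicit Defensive.
Import Order.TTheory GRing.Theory Num.Theory.
Import numFieldNormedType.Exports.
Local Open Scope classical_set_scope.
Local Open Scope ring_scope.

(* Permutations of [n] are elements of 'S_n acting on 'I_n, so that i : 'I_n
   stands for the number i + 1 of [n]. *)

Definition inversions (n : nat) (s : 'S_n) : nat :=
  (\sum_(i < n) \sum_(j < n | i < j) (s j < s i))%N.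

(* (s^-1)%g k is the position of the number k in the one-line notation of s. *)
Definition inv_below (n : nat) (j : 'I_n) (s : 'S_n) : nat :=
  (\sum_(i < n | i < j) ((s^-1)%g j < (s^-1)%g i))%N.

Lemma inv_below_le (n : nat) (j : 'I_n) (s : 'S_n) : (inv_below j s <= j)%N.
Proof.
rewrite /inv_below (@leq_trans (\sum_(i < n | i < j) 1)%N)//.
  by apply: leq_sum => i _; exact: leq_b1.
by rewrite -(big_ord_widen n (fun=> 1%N) (ltnW (ltn_ord j))) sum1_card card_ord.
Qed.

(* The values of a parking function are genuine elements of {1, ..., n}, seen
   in 'I_n.+1 = {0, ..., n}; the condition at j = 0 holds trivially. Only the
   index is shifted: p i is the (i+1)-th coordinate. *)
Definition is_parking (n : nat) (p : {ffun 'I_n -> 'I_n.+1}) : bool :=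
  [forall i, (0 < p i)%N] &&
  [forall j : 'I_n.+1, (j <= #|[set i | (p i <= j)%N]%SET|)%N].

Record parking (n : nat) := Parking {
  parking_val :> {ffun 'I_n -> 'I_n.+1};
  parkingP : is_parking parking_val }.

HB.instance Definition _ (n : nat) := [isSub for @parking_val n].
HB.instance Definition _ (n : nat) := [Finite of parking n by <:].

Lemma inv_below_succ_lt (n : nat) (s : 'S_n) (j : 'I_n) :
  ((inv_below j s).+1 < n.+1)%N.
Proof. by rewrite ltnS (leq_ltn_trans (inv_below_le j s)). Qed.

Definition perm_pair_ffun (n : nat) (st : 'S_n * 'S_n) :
    {ffun 'I_n -> 'I_n.+1} :=
  [ffun i => Ordinal (inv_below_succ_lt st.1 (st.2 i))].

Lemma perm_pair_is_parking (n : nat) (st : 'S_n * 'S_n) :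
  is_parking (perm_pair_ffun st).
Proof.
apply/andP; split; first by apply/forallP => i; rewrite ffunE.
apply/forallP => j.
rewrite (@leq_trans #|st.2 @^-1: [set k : 'I_n | (k < j)%N]%SET|)//.
  rewrite on_card_preimset; last first.
    by apply: onW_bij; exists (st.2^-1)%g; [exact: permK|exact: permKV].
  have jn : (j <= n)%N by rewrite -ltnS.
  rewrite -sum1_card (eq_bigl (fun k : 'I_n => (k < j)%N)); last first.
    by move=> k; rewrite inE.
  by rewrite -(big_ord_widen n (fun=> 1%N) jn) sum1_card card_ord.
apply/subset_leq_card/fintype.subsetP => i; rewrite !inE ffunE /=.
by apply: leq_ltn_trans; exact: inv_below_le.
Qed.

Definition parking_of_perms (n : nat) (st : 'S_n * 'S_n) : parking n :=
  Parking (perm_pair_is_parking st).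

(* 'S_n and parking n carry the discrete sigma-algebra. *)
HB.instance Definition _ (T : finType) := isPointed.Build (perm_type T) 1%g.
HB.instance Definition _ (T : finType) :=
  @isMeasurable.Build default_measure_display (perm_type T) discrete_measurable
    discrete_measurable0 discrete_measurableC discrete_measurableU.

HB.instance Definition _ (n : nat) :=
  isPointed.Build (parking n) (parking_of_perms (1%g, 1%g)).
HB.instance Definition _ (n : nat) :=
  @isMeasurable.Build default_measure_display (parking n) discrete_measurable
    discrete_measurable0 discrete_measurableC discrete_measurableU.

Lemma measurable_perm_pair (T : finType) (A : set ({perm T} * {perm T})) :
  measurable A.
Proof.
rewrite (_ : A = \bigcup_(x in A) ([set x.1] `*` [set x.2])); last first.
  apply/seteqP; split => [[a b] Aab|[a b] [[c d] Acd]] /=.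
    by exists (a, b).
  by case=> /= -> ->.
apply: fin_bigcup_measurable => [|x _]; last exact: measurableX.
exact: finite_finset.
Qed.

Section sum_weights.
Context {R : realType} {T : finType} (w : T -> R).
Hypothesis w_ge0 : forall x, 0 <= w x.

Lemma sum_weights_sigma_additive (F : (set T)^nat) :
  trivIset setT F ->
  (fun k => \sum_(0 <= i < k) \sum_(x \in F i) (w x)%:E)%E @ \oo -->
  (\sum_(x \in \bigcup_i F i) (w x)%:E)%E.
Proof.
move=> tF; apply: cvg_toP.
  apply: ereal_nondecreasing_is_cvgn => m k mk.
  apply: lee_sum_nneg_natr => // i _ _.
  by rewrite fsbig_finite//= sumEFin lee_fin sumr_ge0.
transitivity (\sum_(0 <= i <oo) (\esum_(x in F i) (w x)%:E))%E.
  by apply: eq_eseriesr => k _; rewrite esum_fset//= => x _; rewrite lee_fin.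
rewrite -nneseries_sum_bigcup//= esum_fset//=.
by move=> x _; rewrite lee_fin.
Qed.

Lemma sum_weights_setT :
  (\sum_(x \in [set: T]) (w x)%:E)%E = (\sum_(x : T) w x)%:E.
Proof.
rewrite fsbig_finite//= sumEFin; congr EFin.
apply: perm_big; apply: uniq_perm => [||x].
- exact: finmap.fset_uniq.
- exact: index_enum_uniq.
- rewrite (in_fset_set (@finite_finset T setT)) in_setT.
  by rewrite mem_index_enum.
Qed.

End sum_weights.

Definition mallows_norm (R : realType) (n : nat) (q : R) : R :=
  \sum_(s : 'S_n) q ^+ inversions s.

Definition mallows (R : realType) (n : nat) (q : {posnum R}) :
    set 'S_n -> \bar R :=
  fun A => (\sum_(s \in A) (q%:num ^+ inversions s / mallows_norm n q%:num)%:E)%E.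

Definition uniform_perm (R : realType) (n : nat) : set 'S_n -> \bar R :=
  fun A => (\sum_(s \in A) (n`!%:R^-1 : R)%:E)%E.

Section mallows_probability.
Context {R : realType} (n : nat) (q : {posnum R}).

Lemma mallows_norm_gt0 : 0 < mallows_norm n q%:num.
Proof.
rewrite /mallows_norm (bigD1 1%g)//= ltr_pwDl ?exprn_gt0//.
by apply: sumr_ge0 => s _; rewrite exprn_ge0.
Qed.

Let w_ge0 (s : 'S_n) : 0 <= q%:num ^+ inversions s / mallows_norm n q%:num.
Proof. by rewrite divr_ge0 ?exprn_ge0// ltW// mallows_norm_gt0. Qed.

Let mallows0 : mallows q (set0 : set 'S_n) = 0%E.
Proof. by rewrite /mallows fsbig_set0. Qed.

Let mallows_ge0 (A : set 'S_n) : (0 <= mallows q A)%E.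
Proof. by rewrite /mallows fsbig_finite//= sumEFin lee_fin sumr_ge0. Qed.

Let mallows_sigma_additive : semi_sigma_additive (@mallows R n q).
Proof. by move=> F _ tF _; exact: sum_weights_sigma_additive. Qed.

HB.instance Definition _ := isMeasure.Build _ _ _ (@mallows R n q)
  mallows0 mallows_ge0 mallows_sigma_additive.

Let mallows_setT : mallows q [set: 'S_n] = 1%E.
Proof.
rewrite /mallows sum_weights_setT -mulr_suml divff// gt_eqF//.
exact: mallows_norm_gt0.
Qed.

HB.instance Definition _ := Measure_isProbability.Build _ _ _
  (@mallows R n q) mallows_setT.

End mallows_probability.

Section uniform_perm_probability.
Context {R : realType} (n : nat).

Let w_ge0 (s : 'S_n) : 0 <= (n`!%:R^-1 : R).
Proof. by rewrite invr_ge0. Qed.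

Let uniform_perm0 : uniform_perm R (set0 : set 'S_n) = 0%E.
Proof. by rewrite /uniform_perm fsbig_set0. Qed.

Let uniform_perm_ge0 (A : set 'S_n) : (0 <= uniform_perm R A)%E.
Proof. by rewrite /uniform_perm fsbig_finite//= sumEFin lee_fin sumr_ge0. Qed.

Let uniform_perm_sigma_additive : semi_sigma_additive (@uniform_perm R n).
Proof. by move=> F _ tF _; exact: sum_weights_sigma_additive. Qed.

HB.instance Definition _ := isMeasure.Build _ _ _ (@uniform_perm R n)
  uniform_perm0 uniform_perm_ge0 uniform_perm_sigma_additive.

Let uniform_perm_setT : uniform_perm R [set: 'S_n] = 1%E.
Proof.
rewrite /uniform_perm sum_weights_setT sumr_const card_Sn -[X in X *+ _]mul1r.
by rewrite -mulrnAl divff// pnatr_eq0 -lt0n fact_gt0.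
Qed.

HB.instance Definition _ := Measure_isProbability.Build _ _ _
  (@uniform_perm R n) uniform_perm_setT.

End uniform_perm_probability.

Lemma measurable_parking_of_perms (n : nat) :
  measurable_fun [set: 'S_n * 'S_n] (@parking_of_perms n).
Proof. by move=> _ A _; exact: measurable_perm_pair. Qed.

HB.instance Definition _ (n : nat) := isMeasurableFun.Build _ _ _ _
  (@parking_of_perms n) (@measurable_parking_of_perms n).

Definition parking_mallows (R : realType) (n : nat) (q : {posnum R}) :
    probability (parking n) R :=
  distribution (@mallows R n q \x @uniform_perm R n)%E (@parking_of_perms n).

(* The coordinate pi_1 exists only for a positive length. *)
Definition scaled_first_coord (R : realType) (alpha : R) (n : nat)
    (p : parking n.+1) : R :=
  (p ord0 : nat)%:R / n.+1%:R `^ alpha.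

Lemma measurable_scaled_first_coord (R : realType) (alpha : R) (n : nat) :
  measurable_fun [set: parking n.+1] (@scaled_first_coord R alpha n).
Proof. by []. Qed.

HB.instance Definition _ (R : realType) (alpha : R) (n : nat) :=
  isMeasurableFun.Build _ _ _ _ (@scaled_first_coord R alpha n)
    (@measurable_scaled_first_coord R alpha n).

Definition cvg_in_distribution (R : realType) (d : measure_display)
    (T : nat -> measurableType d) (P : forall n, probability (T n) R)
    (X : forall n, {RV (P n) >-> R})
    (mu : probability (measurableTypeR R) R) : Prop :=
  forall x : R, {for x, continuous (fun y => mu `]-oo, y]%classic)} ->
    cdf (X n) x @[n --> \oo] --> mu `]-oo, x]%classic.

Definition exponential_law (R : realType) (c : R) (c_gt0 : 0 < c) :
    probability (measurableTypeR R) R :=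
  exponential_distribution_exponential_prob__canonical__probability_measure_Probability
    c_gt0.

Lemma exponential_lawE (R : realType) (c : R) (c_gt0 : 0 < c) (A : set R) :
  exponential_law c_gt0 A =
  (\int[lebesgue_measure]_(x in A) (exponential_pdf c x)%:E)%E.
Proof. by []. Qed.

(* Main.v *)
(* The map sending a permutation to the vector of its [inv_below j] is
   a bijection onto the product of the ranges [0 .. j] and turns the number of
   inversions into the sum of the entries. Hence under the Mallows measure
   [inv_below j] is a geometric variable truncated at [j], and averaging over the
   uniform position of [tau] gives, with [j] running over [1 .. n],
     P(pi_1 <= m) = 1/n * sum_j (1 - q^(min m j)) / (1 - q^j).
   Each summand lies between [1 - q^m] and [1 - q^m + q^j], so this probability
   differs from [1 - q^m] by at most [1 / (n (1 - q)) = n^(alpha - 1) / c], which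
   tends to 0; and [q^m] tends to [exp (- c x)] for [m] the integral part of
   [x n^alpha]. *)
Require Import Defs.
From mathcomp Require Import all_boot all_order all_algebra all_fingroup.
From mathcomp Require Import all_classical all_reals all_analysis.
From mathcomp Require Import ring lra.
Import Order.TTheory GRing.Theory Num.Theory.
Import numFieldNormedType.Exports.
Local Open Scope classical_set_scope.
Local Open Scope ring_scope.

(** * Inversion tables of permutations *)

(** Each inversion is counted at its larger value: reindexing both sums by [s^-1] trades pairs of
    positions for pairs of values. *)
Lemma sum_inv_below (n : nat) (s : 'S_n) :
  (\sum_(j < n) inv_below j s)%N = inversions s.
Proof.
rewrite /inversions.
under eq_bigr do rewrite /inv_below big_mkcond/=.
under [RHS]eq_bigr do rewrite big_mkcond/=.
rewrite [RHS](reindex_perm (s^-1)%g)/=.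
apply: eq_bigr => j _.
rewrite [RHS](reindex_perm (s^-1)%g)/=.
apply: eq_bigr => i _.
rewrite !permKV.
by case: ltnP; case: ltnP.
Qed.

(* Two up-sets of a totally ordered set are nested, so equal counts make them
   equal: the relative order of the positions of [0 .. j] is recovered step by
   step. *)
Lemma inv_below_order (n : nat) (s t : 'S_n) :
  (forall j, inv_below j s = inv_below j t) ->
  forall a b, ((s^-1)%g a < (s^-1)%g b)%N = ((t^-1)%g a < (t^-1)%g b)%N.
Proof.
move=> st.
suff H m : forall a b : 'I_n, (a < m)%N -> (b < m)%N ->
    ((s^-1)%g a < (s^-1)%g b)%N = ((t^-1)%g a < (t^-1)%g b)%N.
  by move=> a b; exact: (H n).
elim: m => // m IH a b.
have {}IH (i k : 'I_n) : (i < m)%N -> (k < m)%N ->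
    ((s^-1)%g i < (s^-1)%g k)%N = ((t^-1)%g i < (t^-1)%g k)%N := @IH i k.
have last (i j : 'I_n) : j = m :> nat -> (i < m)%N ->
    ((s^-1)%g j < (s^-1)%g i)%N = ((t^-1)%g j < (t^-1)%g i)%N.
  move=> jm im.
  (* [A u] collects the values below [m] placed after [m]: an up-set for the order of positions, on
     which [s] and [t] agree by induction. *)
  pose A (u : 'S_n) := [set k : 'I_n | (k < m) && ((u^-1)%g j < (u^-1)%g k)]%SET%N.
  have cardA u : #|A u| = inv_below j u.
    rewrite /inv_below -sum1_card big_mkcond [RHS]big_mkcond jm.
    by apply: eq_bigr => k _; rewrite inE; case: (k < m)%N => //=; case: ltnP.
  suff AE : A s = A t by have := congr1 (fun B : {set _} => i \in B) AE; rewrite !inE im.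
  have card_st : #|A s| = #|A t| by rewrite !cardA st.
  have [sub|/fintype.subsetPn[k]] := boolP (A s \subset A t).
    by apply/eqP; rewrite eqEcard sub card_st/=.
  (* A [k] in [A s] but not in [A t] lies, in [t], before all of [A t]; by induction also in [s],
     which forces [A t] inside [A s]. *)
  rewrite !inE => /andP[km sk]; rewrite km/= -leqNgt => tk.
  apply/esym/eqP; rewrite eqEcard card_st leqnn andbT.
  apply/fintype.subsetP => l; rewrite !inE => /andP[lm tl]; rewrite lm/=.
  apply: (leq_trans sk); rewrite leqNgt IH// -leqNgt.
  exact/ltnW/(leq_ltn_trans tk).
have flip (u : 'S_n) (i j : 'I_n) : i != j ->
    ((u^-1)%g i < (u^-1)%g j)%N = ~~ ((u^-1)%g j < (u^-1)%g i)%N.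
  move=> ij; rewrite -leqNgt [RHS]leq_eqVlt.
  have /negPf -> // : (u^-1)%g i != (u^-1)%g j :> nat.
  by apply: contra ij => /eqP/val_inj/perm_inj ->.
rewrite !ltnS leq_eqVlt => /orP[/eqP am|am]; rewrite leq_eqVlt => /orP[/eqP bm|bm].
- have -> : a = b by apply: val_inj; rewrite /= am bm.
  by rewrite !ltnn.
- exact: last.
- have ab : a != b by rewrite -(inj_eq val_inj)/= bm ltn_eqF.
  by rewrite !(flip _ a b)// last.
- exact: IH.
Qed.

Lemma inv_below_inj (n : nat) (s t : 'S_n) :
  (forall j, inv_below j s = inv_below j t) -> s = t.
Proof.
move=> /inv_below_order st.
apply: invg_inj; apply/permP => a; apply: val_inj => /=.
(* Applied to inverses, this recovers a position from the order alone: it is the number of values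
   placed earlier. *)
have rank (u : 'S_n) : #|[set b | (u b < u a)%N]%SET| = u a.
  have -> : [set b | (u b < u a)%N]%SET = u @^-1: [set k : 'I_n | (k < u a)%N]%SET.
    by apply/setP => b; rewrite !inE.
  rewrite on_card_preimset; last first.
    by apply: onW_bij; exists (u^-1)%g; [exact: permK|exact: permKV].
  rewrite -sum1_card (eq_bigl (fun k : 'I_n => (k < u a)%N)); last first.
    by move=> k; rewrite inE.
  by rewrite -(big_ord_widen n (fun=> 1%N) (ltnW (ltn_ord (u a)))) sum1_card card_ord.
rewrite -(rank (s^-1)%g) -(rank (t^-1)%g).
by apply: eq_card => b; rewrite !inE st.
Qed.

(** The inversion table; entries stay in ['I_n], so that codes form a plain function type, and the
    bound by [j] returns through [family]. *)
Definition inv_code {n : nat} (s : 'S_n) : {ffun 'I_n -> 'I_n} :=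
  [ffun j => Ordinal (leq_ltn_trans (inv_below_le j s) (ltn_ord j))].

Lemma inv_code_inj (n : nat) : injective (@inv_code n).
Proof.
move=> s t st; apply: (@inv_below_inj n) => j.
by have /ffunP/(_ j)/(congr1 val) := st; rewrite !ffunE.
Qed.

Lemma card_ord_leq (n : nat) (j : 'I_n) : #|[pred k : 'I_n | (k <= j)%N]| = j.+1.
Proof.
rewrite -sum1_card (eq_bigl (fun k : 'I_n => (k < j.+1)%N))//.
by rewrite -(big_ord_widen n (fun=> 1%N) (ltn_ord j)) sum1_card card_ord.
Qed.

(** Counting gives equality: the code is injective, and both sets have [n!] elements, the product of
    the [j + 1]. *)
Lemma inv_code_image (n : nat) :
  [set inv_code s | s : 'S_n]%SET =
  [set f in family (fun j : 'I_n => [pred k : 'I_n | (k <= j)%N])]%SET.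
Proof.
apply/eqP; rewrite eqEcard; apply/andP; split.
  apply/fintype.subsetP => _ /imsetP[s _ ->]; rewrite inE.
  by apply/familyP => j; rewrite ffunE inE /= inv_below_le.
rewrite card_imset; last exact: inv_code_inj.
rewrite card_Sn cardsE card_family foldrE big_map enumT.
under eq_bigr do rewrite card_ord_leq.
rewrite leq_eqVlt; apply/orP; left; apply/eqP.
elim: n => [|n IH]; first by rewrite big_ord0.
by rewrite big_ord_recr/= IH factS mulnC.
Qed.

(** * Factorization of the Mallows weight *)

(** Once the sum runs over codes, distributivity factors it: the entries behave as independent
    variables. *)
Lemma sum_prod_inv_below (R : comRingType) (n : nat) (g : 'I_n -> nat -> R) :
  \sum_(s : 'S_n) \prod_(j < n) g j (inv_below j s) =
  \prod_(j < n) \sum_(k < j.+1) g j k.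
Proof.
transitivity (\prod_(j < n) \sum_(k < n | (k <= j)%N) g j k); last first.
  by apply: eq_bigr => j _; rewrite (big_ord_widen n (g j))//; exact: ltn_ord.
rewrite (bigA_distr_big_dep _ (fun j k => g j (nat_of_ord k))).
transitivity (\sum_(f in [set inv_code s | s : 'S_n]%SET) \prod_(j < n) g j (f j)).
  rewrite big_imset/=; last by move=> s t _ _; exact: inv_code_inj.
  by apply: eq_bigr => s _; apply: eq_bigr => j _; rewrite ffunE.
by rewrite inv_code_image; apply: eq_bigl => f; rewrite inE.
Qed.

(** The truncated geometric law of one entry, cross-multiplied so that it makes sense over a
    ring. *)
Lemma sum_inversions_inv_below (R : comRingType) (n : nat) (q : R) (j : 'I_n)
    (P : pred nat) :
  (\sum_(s : 'S_n | P (inv_below j s)) q ^+ inversions s) * \sum_(k < j.+1) q ^+ k =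
  (\sum_(s : 'S_n) q ^+ inversions s) * \sum_(k < j.+1 | P k) q ^+ k.
Proof.
(* The indicator of [B] sits on the factor [j] only, so the sums for [P] and for the full predicate
   share all other factors. *)
pose g (B : pred nat) (i : 'I_n) (k : nat) : R :=
  q ^+ k * (if i == j then (B k)%:R else 1).
have sumg B : \sum_(s : 'S_n | B (inv_below j s)) q ^+ inversions s =
    (\sum_(k < j.+1 | B k) q ^+ k) *
    \prod_(i < n | i != j) \sum_(k < i.+1) q ^+ k.
  transitivity (\sum_(s : 'S_n) \prod_(i < n) g B i (inv_below i s)).
    rewrite big_mkcond/=; apply: eq_bigr => s _.
    rewrite big_split/= -expr_sum sum_inv_below (bigD1 j)//= eqxx big1 ?mulr1.
      by case: ifP; rewrite ?mulr1 ?mulr0.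
    by move=> i /negPf ->.
  rewrite sum_prod_inv_below (bigD1 j)//=; congr (_ * _).
    rewrite [RHS]big_mkcond/=; apply: eq_bigr => k _.
    by rewrite /g eqxx; case: ifP; rewrite ?mulr1 ?mulr0.
  apply: eq_bigr => i /negPf ij; apply: eq_bigr => k _.
  by rewrite /g ij mulr1.
rewrite (sumg P) [X in _ = X * _](sumg xpredT)/=.
by rewrite -mulrA mulrC [_ * \sum_(k < j.+1) _]mulrC.
Qed.

(** * From measures to finite sums: the law of the first coordinate *)

Lemma fsbig_finType (R : realType) (T : finType) (w : T -> R) (P : pred T) :
  (\sum_(x \in [set x | P x]) (w x)%:E)%E = (\sum_(x | P x) w x)%:E.
Proof.
rewrite fsbig_mkcond [in RHS]big_mkcond.
rewrite -[RHS](sum_weights_setT (fun x => if P x then w x else 0)).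
apply: eq_fsbigr => x _; rewrite patchE/=.
by case: ifPn => [|]; rewrite ?inE ?notin_setE/= => Px; [rewrite Px|case: ifP].
Qed.

Lemma sum_perm_image (R : numFieldType) (n : nat) (f : 'I_n -> R) (i : 'I_n) :
  \sum_(t : 'S_n) f (t i) / n`!%:R = (\sum_(j < n) f j) / n%:R.
Proof.
have n_gt0 : (0 < n)%N by exact: leq_ltn_trans (ltn_ord i).
(* Composition with a transposition makes the sum independent of [k]; summing over all [k] then
   gives [n!] times the sum of [f]. *)
have same k : \sum_(t : 'S_n) f (t k) = \sum_(t : 'S_n) f (t i).
  rewrite (reindex_inj (mulgI (tperm k i))).
  by apply: eq_bigr => t _; rewrite permM tpermL.
rewrite -mulr_suml; apply/eqP.
rewrite eqr_div ?pnatr_eq0 -?lt0n ?fact_gt0//; apply/eqP.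
transitivity (\sum_(k < n) \sum_(t : 'S_n) f (t k)).
  by rewrite (eq_bigr _ (fun k _ => same k)) sumr_const card_ord mulr_natr.
rewrite exchange_big/=.
rewrite (eq_bigr (fun=> \sum_(j < n) f j)) => [|t _]; last first.
  by rewrite [RHS](reindex_perm t).
by rewrite sumr_const card_Sn mulr_natr.
Qed.

Lemma parking_mallows_first_coord (R : realType) (n : nat) (q : {posnum R})
    (P : pred nat) :
  parking_mallows n.+1 q [set p : parking n.+1 | P (p ord0)] =
  ((\sum_(j < n.+1) (\sum_(s : 'S_n.+1 | P (inv_below j s).+1)
      q%:num ^+ inversions s) / mallows_norm n.+1 q%:num) / n.+1%:R)%:E.
Proof.
rewrite -(@sum_perm_image _ _ (fun j => _ / _) ord0).
(* The event splits, according to the second permutation [t], into disjoint rectangles [A t] times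
   [{t}]. *)
pose A (t : 'S_n.+1) := [set s : 'S_n.+1 | P (inv_below (t ord0) s).+1].
have preE : @parking_of_perms n.+1 @^-1` [set p : parking n.+1 | P (p ord0)] =
    \bigcup_(t in [set: 'S_n.+1]) (A t `*` [set t]).
  apply/seteqP; split=> [[s t]|[s t] [u _]]/=.
    by rewrite ffunE /= => Pst; exists t.
  by rewrite ffunE => -[/= ? ->].
transitivity ((@mallows R n.+1 q \x @uniform_perm R n.+1)%E
    (\bigcup_(t in [set: 'S_n.+1]) (A t `*` [set t]))).
  by rewrite -preE.
rewrite measure_fin_bigcup; last 3 first.
- exact: finite_finset.
- by move=> t u _ _ [[s v] [[_ /= <-] [_ /= <-]]].
- by move=> t _; exact: measurable_perm_pair.
rewrite -[RHS](sum_weights_setT (fun t : 'S_n.+1 => _ / _)); apply: eq_fsbigr => t _.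
rewrite [LHS](@product_measure1E _ _ _ _ R (@mallows R n.+1 q)
  (@uniform_perm R n.+1) (A t) [set t])//.
rewrite [X in (_ * X)%E]fsbig_set1.
by rewrite [X in (X * _)%E]fsbig_finType -EFinM -mulr_suml.
Qed.

(** * Geometric sums and the estimate at fixed length *)

Lemma sum_geometric (R : fieldType) (q : R) (n : nat) :
  q != 1 -> \sum_(k < n) q ^+ k = (1 - q ^+ n) / (1 - q).
Proof.
move=> q1; have d0 : 1 - q != 0 by rewrite subr_eq0 eq_sym.
apply: (mulIf d0); rewrite mulfVK// -[RHS]opprB subrX1; ring.
Qed.

Lemma truncated_geometric_bounds (R : realFieldType) (q : R) (j m : nat) :
  0 < q < 1 ->
  1 - q ^+ m <=
    (\sum_(k < j.+1 | (k < m)%N) q ^+ k) / \sum_(k < j.+1) q ^+ k <=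
  1 - q ^+ m + q ^+ j.+1.
Proof.
move=> /andP[q0 q1].
have qV : 1 - q != 0 by rewrite subr_eq0 gt_eqF.
have J1 : q ^+ j.+1 < 1 by rewrite exprn_ilt1 ?ltW.
have J0 : 0 < q ^+ j.+1 by rewrite exprn_gt0.
have JV : 1 - q ^+ j.+1 != 0 by rewrite subr_eq0 gt_eqF.
rewrite [X in _ / X]sum_geometric ?(lt_eqF q1)//.
(* If [m] exceeds [j], the ratio is 1 and [q ^+ m <= q ^+ j.+1] gives the upper bound. *)
have [jm|mj] := leqP j.+1 m.
  rewrite (eq_bigl xpredT) => [|k]; last by rewrite (leq_trans (ltn_ord k)).
  rewrite sum_geometric ?(lt_eqF q1)// divff ?mulf_neq0 ?invr_eq0//.
  have := exprn_gt0 m q0.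
  have : q ^+ m <= q ^+ j.+1 by rewrite ler_wiXn2l// ltW.
  lra.
rewrite -(big_ord_widen _ (fun k => q ^+ k) (ltnW mj)) sum_geometric ?(lt_eqF q1)//.
rewrite invf_div mulrA divfK//.
have MJ : q ^+ j.+1 <= q ^+ m by rewrite ler_wiXn2l ?(ltW q0) ?(ltW q1)// ltnW.
have M1 : q ^+ m <= 1 by rewrite exprn_ile1 ?ltW.
(* With [a = q ^+ m] and [b = q ^+ j.+1], the upper bound amounts to [0 <= b * (a - b)]. *)
rewrite ler_pdivlMr ?ler_pdivrMr ?subr_gt0//; nra.
Qed.

Lemma first_coord_le_bounds (R : realType) (n m : nat) (q : {posnum R}) :
  q%:num < 1 ->
  1 - q%:num ^+ m <=
    (\sum_(j < n.+1) (\sum_(s : 'S_n.+1 | (inv_below j s < m)%N)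
      q%:num ^+ inversions s) / mallows_norm n.+1 q%:num) / n.+1%:R <=
  1 - q%:num ^+ m + (n.+1%:R * (1 - q%:num))^-1.
Proof.
move=> q1.
have ratio j : (\sum_(s : 'S_n.+1 | (inv_below j s < m)%N)
      q%:num ^+ inversions s) / mallows_norm n.+1 q%:num =
    (\sum_(k < j.+1 | (k < m)%N) q%:num ^+ k) / \sum_(k < j.+1) q%:num ^+ k.
  have K0 : mallows_norm n.+1 q%:num != 0 by rewrite gt_eqF// mallows_norm_gt0.
  have G0 : \sum_(k < j.+1) q%:num ^+ k != 0.
    by rewrite sum_geometric ?(lt_eqF q1)// mulf_neq0 ?invr_eq0// subr_eq0 gt_eqF// exprn_ilt1.
  apply/eqP; rewrite eqr_div//; apply/eqP; rewrite [RHS]mulrC.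
  exact: (@sum_inversions_inv_below _ _ _ j (fun k => (k < m)%N)).
under eq_bigr do rewrite ratio.
have bnd j := @truncated_geometric_bounds R q%:num j m.
have q01 : 0 < q%:num < 1 by rewrite q1 andbT.
rewrite ler_pdivlMr ?ltr0Sn// ler_pdivrMr ?ltr0Sn//; apply/andP; split.
  rewrite mulr_natr -[n.+1 in leLHS]card_ord -sumr_const ler_sum// => j _.
  by have /andP[] := bnd j q01.
rewrite mulrDl invfM mulrAC mulVf ?pnatr_eq0// mul1r mulr_natr.
rewrite -[n.+1 in leRHS]card_ord -sumr_const.
apply: (@le_trans _ _ (\sum_(j < n.+1) (1 - q%:num ^+ m + q%:num ^+ j.+1))).
  by apply: ler_sum => j _; have /andP[] := bnd j q01.
rewrite big_split/= lerD2l.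
under eq_bigr do rewrite exprS.
rewrite -mulr_sumr sum_geometric ?(lt_eqF q1)// mulrA.
(* The errors add up to [q * (1 - q ^+ n.+1) / (1 - q)], whose numerator is at most 1. *)
apply: ler_piMl; first by rewrite invr_ge0 subr_ge0 ltW.
apply: mulr_ile1; rewrite ?(ltW q1)// ?subr_ge0 ?exprn_ile1 ?(ltW q1)//.
Qed.

(** * Limits of powers *)

Lemma cvg_powR_nat (R : realType) (a : R) :
  0 < a -> n.+1%:R `^ a @[n --> \oo] --> +oo.
Proof.
move=> a0; apply/cvgryPge => A; near=> n.
(* The cut at 0 lets the powers [a^-1] and [a] cancel. *)
apply: (@le_trans _ _ ((Num.max A 0 `^ a^-1) `^ a)).
  by rewrite -powRrM mulVf ?gt_eqF// powRr1 le_max lexx ?orbT.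
apply: ge0_ler_powR; rewrite ?nnegrE ?powR_ge0 ?(ltW a0)//.
apply: (@le_trans _ _ n%:R); last by rewrite ler_nat.
by near: n; exact: nbhs_infty_ger.
Unshelve. all: end_near. Qed.

(** With [t = c / N n], the bounds [exp (- t / (1 - t)) <= 1 - t <= exp (- t)] are raised to a power
    [m] with [x * N n - 1 < m <= x * N n]. *)
Lemma cvg_geometric_truncn (R : realType) (c x : R) (N : nat -> R) :
  0 < c -> 0 <= x -> N n @[n --> \oo] --> +oo ->
  (1 - c / N n) ^+ Num.truncn (x * N n) @[n --> \oo] --> expR (- (c * x)).
Proof.
move=> c0 x0 Ny.
have NV0 : (N n)^-1 @[n --> \oo] --> 0.
  have pos : \forall n \near \oo, 0 < N n by exact: ((cvgryPgt N).1 Ny 0).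
  exact: ((gtr0_cvgV0 pos).2 Ny).
have tV0 : c / N n @[n --> \oo] --> 0.
  by rewrite -(mulr0 c); apply: cvgMr.
apply: (@squeeze_cvgr _ _ _ _
  (fun n => expR (- (c * x * (1 - c / N n)^-1)))
  (fun n => expR (- (c * x) + c / N n))); last 2 first.
- apply: continuous_cvg; first exact: continuous_expR.
  apply: cvgN; rewrite -[X in _ --> X]mulr1; apply: cvgMr.
  rewrite -[X in _ --> X]invr1; apply: cvgV; first exact: oner_neq0.
  by rewrite -[X in _ --> X]subr0; apply: cvgB => //; exact: cvg_cst.
- apply: continuous_cvg; first exact: continuous_expR.
  by rewrite -[X in _ --> X]addr0; apply: cvgD => //; exact: cvg_cst.
near=> n.
have N0 : 0 < N n by near: n; exact: ((cvgryPgt N).1 Ny _).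
have Nc : c < N n by near: n; exact: ((cvgryPgt N).1 Ny _).
have t1 : 0 < 1 - c / N n by rewrite subr_gt0 ltr_pdivrMr// mul1r.
have t0 : 0 < c / N n by rewrite divr_gt0.
have /andP[mle mgt] := truncn_itv (mulr_ge0 x0 (ltW N0)).
set m := Num.truncn _ in mle mgt *.
have cx : c * x = c / N n * (x * N n) by field; rewrite gt_eqF.
apply/andP; split.
- apply: (@le_trans _ _ (expR (- (c / N n / (1 - c / N n))) ^+ m)).
    rewrite -expRM_natr ler_expR mulNr lerN2 cx mulrAC.
    by rewrite ler_wpM2r ?invr_ge0 ?(ltW t1)// ler_wpM2l ?(ltW t0).
  rewrite lerXn2r ?nnegrE ?expR_ge0 ?(ltW t1)//.
  (* After inversion the claim is [1 / (1 - t) = 1 + t / (1 - t) <= exp (t / (1 - t))]. *)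
  rewrite expRN invf_ple ?posrE ?expR_gt0//.
  apply: le_trans (expR_ge1Dx _).
  rewrite le_eqVlt; apply/orP; left; apply/eqP.
  by field; rewrite subr_eq0 !gt_eqF.
- apply: (@le_trans _ _ (expR (- (c / N n)) ^+ m)).
    by rewrite lerXn2r ?nnegrE ?expR_ge0 ?(ltW t1)// expR_ge1Dx.
  rewrite -expRM_natr ler_expR mulNr cx.
  rewrite -subr_ge0.
  have -> : - (c / N n * (x * N n)) + c / N n - - (c / N n * m%:R) =
    c / N n * (m%:R + 1 - x * N n) by ring.
  by rewrite mulr_ge0 ?(ltW t0)// subr_ge0 natr1 ltW.
Unshelve. all: end_near. Qed.

(** * The exponential distribution function and the convergence *)

Lemma exponential_law_cdf (R : realType) (c x : R) (c_gt0 : 0 < c) :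
  exponential_law c_gt0 `]-oo, x]%classic =
  (if 0 <= x then 1 - expR (- (c * x)) else 0)%:E.
Proof.
have neg (A : set R) : A `<=` `]-oo, 0[%classic -> exponential_law c_gt0 A = 0%E.
  move=> A0; rewrite exponential_lawE integral0_eq// => y /A0/=.
  by rewrite in_itv/= => y0; rewrite lt0_exponential_pdf.
case: ifPn => [x0|]; last first.
  rewrite -ltNge => x0; apply: neg => y /=; rewrite !in_itv/= => yx.
  exact: le_lt_trans yx x0.
have -> : `]-oo, x]%classic = `]-oo, 0[%classic `|` `[0, x]%classic :> set R.
  by rewrite -itv_bndbnd_setU// bnd_simp.
rewrite measureU//; last first.
  apply/seteqP; split => y //=; rewrite !in_itv/= => -[y0 /andP[]].
  by rewrite leNgt y0.
(* The point 0 is treated apart because the formula for [[0, x]] requires [0 < x]. *)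
rewrite [X in (X + _)%E](neg `]-oo, 0[%classic)// add0e; have [->|xn0] := eqVneq x 0.
  by rewrite [LHS]exponential_lawE set_itv1 integral_set1 mulr0 oppr0 expR0 subrr.
rewrite [LHS]exponential_prob_itv0c ?lt_neqAle 1?eq_sym ?xn0//.
by rewrite -mulNr EFinB.
Qed.

Theorem theorem3 (R : realType) (c alpha : R) (c_gt0 : 0 < c)
    (alpha01 : 0 < alpha < 1) (q : nat -> {posnum R})
    (hq : \forall n \near \oo, (q n)%:num = 1 - c / n%:R `^ alpha) :
  cvg_in_distribution
    (fun n => @scaled_first_coord R alpha n
              : {RV (parking_mallows n.+1 (q n.+1)) >-> R})
    (exponential_law c_gt0).
Proof.
move=> x _.
pose N n : R := n.+1%:R `^ alpha.
pose m n := Num.truncn (x * N n).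
pose F n : R := (\sum_(j < n.+1) (\sum_(s : 'S_n.+1 | (inv_below j s < m n)%N)
  (q n.+1)%:num ^+ inversions s) / mallows_norm n.+1 (q n.+1)%:num) / n.+1%:R.
have /andP[a0 a1] := alpha01.
have Npos n : 0 < N n by rewrite powR_gt0.
have cdfE n : cdf (@scaled_first_coord R alpha n
    : {RV (parking_mallows n.+1 (q n.+1)) >-> R}) x = (F n)%:E.
  transitivity (parking_mallows n.+1 (q n.+1)
    [set p : parking n.+1 | (p ord0)%:R / N n <= x]).
    by [].
  rewrite (@parking_mallows_first_coord _ _ _ (fun k => k%:R / N n <= x)).
  congr EFin; congr (_ / _); apply: eq_bigr => j _; congr (_ / _).
  (* For every real [y], [k.+1 <= y] means [k < truncn y]; this absorbs the shift by one in the
     coordinate. *)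
  by apply: eq_bigl => s; rewrite truncn_gt_nat ler_pdivrMr.
under eq_cvg do rewrite cdfE.
have -> : exponential_law c_gt0 `]-oo, x]%classic =
    (if 0 <= x then 1 - expR (- (c * x)) else 0)%:E by exact: exponential_law_cdf.
apply: cvg_EFin; first exact: nearW.
rewrite (_ : fine \o _ = F)//.
have qE : \forall n \near \oo, (q n.+1)%:num = 1 - c / N n.
  by have [M _ HM] := hq; exists M => // n Mn; apply: HM; exact: leqW.
have Ny : N n @[n --> \oo] --> +oo by exact: cvg_powR_nat.
have limq : 1 - (1 - c / N n) ^+ m n @[n --> \oo] -->
    if 0 <= x then 1 - expR (- (c * x)) else 0.
  case: ifPn => [x0|]; first by apply: cvgB; [exact: cvg_cst|exact: cvg_geometric_truncn].
  rewrite -ltNge => x0; rewrite (_ : (fun n => _) = (fun=> 0)); first exact: cvg_cst.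
  (* For negative [x] the truncation takes its default value 0, so the power is 1. *)
  apply/funext => n; rewrite /m (_ : Num.truncn _ = 0)%N ?expr0 ?subrr//.
  by apply/truncn0Pn; rewrite -ltNge (le_lt_trans _ ltr01)// mulr_le0_ge0 ?ltW.
apply: (@squeeze_cvgr _ _ _ _ (fun n => 1 - (1 - c / N n) ^+ m n)
  (fun n => 1 - (1 - c / N n) ^+ m n + (c * n.+1%:R `^ (1 - alpha))^-1)) => //.
- near=> n.
  have qn : (q n.+1)%:num = 1 - c / N n by near: n.
  have q1 : (q n.+1)%:num < 1 by rewrite qn gtrBl divr_gt0.
  have := @first_coord_le_bounds R n (m n) (q n.+1) q1; rewrite -/(F n).
  have -> : n.+1%:R * (1 - (q n.+1)%:num) = c * n.+1%:R `^ (1 - alpha).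
    rewrite qn subKr powRB ?powRr1// ?pnatr_eq0 ?implybT//.
    by rewrite mulrCA.
  by rewrite qn.
- rewrite -[X in _ --> X]addr0; apply: cvgD => //.
  have M0 : \forall n \near \oo, 0 < n.+1%:R `^ (1 - alpha) :> R.
    by apply: nearW => n; rewrite powR_gt0.
  have oneBa_gt0 : 0 < 1 - alpha by rewrite subr_gt0.
  under eq_cvg do rewrite invfM.
  have : c^-1 * (n.+1%:R `^ (1 - alpha))^-1 @[n --> \oo] --> c^-1 * 0.
    by apply: cvgMr; exact: ((gtr0_cvgV0 M0).2 (cvg_powR_nat _ _ oneBa_gt0)).
  by rewrite mulr0.
Unshelve. all: end_near. Qed.
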